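(* Let $\mathcal{S}=(C_1\cup C_2,\Sigma,\mathcal{P})$ be a system with $\mathcal{P}\subseteq\Sigma\times(\Sigma_1\cup\Sigma_2)$. Let $R$ be a deterministic finite automaton over $\Sigma$ (risk specification) and $A$ a deterministic finite automaton over $\Sigma$ (assumption), with complement $\overline{A}$. Let $\mathcal{P}_1\subseteq\Sigma\times\Sigma_1$ and $\mathcal{P}_2\subseteq\Sigma\times\Sigma_2$ be two non-conflicting sets of priorities, and let $\mathcal{S}_{1+}=(C_1\cup\{d_1\},\Sigma,(\mathcal{P}\cap\Sigma\times\Sigma_1)\cup\mathcal{P}_1)$ and $\mathcal{S}_{2+}=(C_2\cup\{d_2\},\Sigma,(\mathcal{P}\cap\Sigma\times\Sigma_2)\cup\mathcal{P}_2)$. If $\mathcal{L}(\mathcal{S}_{1+})\cap\mathcal{L}(R)\cap\mathcal{L}(A)=\emptyset$ and $\mathcal{L}(\mathcal{S}_{2+})\cap\mathcal{L}(\overline{A})=\emptyset$, then the system $\mathcal{S}_+=(C_1\cup C_2,\Sigma,\mathcal{P}\cup\mathcal{P}_1\cup\mathcal{P}_2)$ is B-safe with respect to $R$, i.e., $\mathcal{L}(\mathcal{S}_+)\cap\mathcal{L}(R)=\emptyset$.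
   Context: A system is a tuple $\mathcal{S}=(C,\Sigma,\mathcal{P})$ where $\Sigma$ is a finite set of interaction labels; $C$ is a finite set of components, each $C_i=(L_i,V_i,\Sigma_i',T_i,l_i^0,e_i^0)$ with $L_i$ a finite set of locations, $V_i$ a finite set of Boolean variables, $\Sigma_i'\subseteq\Sigma$ its alphabet, $T_i$ a set of transitions $(l,g,\sigma,f,l')$ with $l,l'\in L_i$, guard $g$ a Boolean formula over $V_i$, $\sigma\in\Sigma_i'$, and update $f$ mapping each $v\in V_i$ to a Boolean formula over $V_i$; $l_i^0$ is the initial location and $e_i^0$ the initial evaluation. $\mathcal{P}\subseteq\Sigma\times\Sigma$ is a priority relation. A configuration assigns each component a location and evaluation; the initial configuration $c^0$ uses the initial ones. $\sigma$ satisfies joint participation in configuration $c$ if every component whose alphabet contains $\sigma$ has a transition labelled $\sigma$ from its current location with guard true under its current evaluation; $\sigma$ is enabled if it satisfies joint participation and there is no $\bar\sigma$ satisfying joint participation with $(\sigma,\bar\sigma)\in\mathcal{P}$. If $\sigma$ is enabled in $c$, $c\xrightarrow{\sigma}c'$ when each component whose alphabet contains $\sigma$ takes such a transition $(l,g,\sigma,f,l')$ (new location $l'$, new evaluation $e'(v)=f(v)(e)$) and all other components are unchanged. The language $\mathcal{L}(\mathcal{S})$ is the set of words $\sigma_1\cdots\sigma_k\in\Sigma^*$ such that there are configurations $c^0\xrightarrow{\sigma_1}c_1\cdots\xrightarrow{\sigma_k}c_k$. For a DFA $R$, $\mathcal{L}(R)$ is its language; $\mathcal{S}$ is B-safe w.r.t.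 $R$ if $\mathcal{L}(\mathcal{S})\cap\mathcal{L}(R)=\emptyset$. $\mathcal{L}(\overline{A})=\Sigma^*\setminus\mathcal{L}(A)$. Decomposition: $C_1$ and $C_2$ are sets of components, and $\Sigma$ is partitioned into $\Sigma_{12}$ (interactions appearing in components of both $C_1$ and $C_2$), $\Sigma_1$ (interactions appearing only in components of $C_1$) and $\Sigma_2$ (interactions appearing only in components of $C_2$). For $i=1,2$, $d_i$ is a component with a single location, no variables, and, for each $\sigma\in\Sigma_{3-i}$, a self-loop transition labelled $\sigma$ with guard true (simulating stuttering). $\mathcal{P}_1,\mathcal{P}_2$ non-conflicting means there is no conflict between them, i.e., $\mathcal{P}\cup\mathcal{P}_1\cup\mathcal{P}_2$ is still a legal priority relation (transitive and irreflexive). *)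

(* Defs.v *)
From mathcomp Require Import all_boot.
From mathcomp Require Import boolp classical_sets.

Set Implicit Arguments.
Unset Strict Implicit.
Unset Printing Implicit Defensive.

Local Open Scope classical_set_scope.

Inductive formula (V : Type) : Type :=
| FVar of V
| FTrue
| FFalse
| FNot of formula V
| FAnd of formula V & formula V
| FOr of formula V & formula V.

Arguments FTrue {V}.
Arguments FFalse {V}.

Fixpoint feval (V : Type) (e : V -> bool) (g : formula V) : bool :=
  match g with
  | FVar v => e v
  | FTrue => true
  | FFalse => false
  | FNot g1 => ~~ feval e g1
  | FAnd g1 g2 => feval e g1 && feval e g2
  | FOr g1 g2 => feval e g1 || feval e g2
  end.

Record transition (L V Sigma : Type) := Transition {
  tsrc : L;
  tguard : formula V;
  tlabel : Sigma;
  tupdate : V -> formula V;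
  ttgt : L
}.

Record component (Sigma : finType) := Component {
  loc : finType;
  var : finType;
  alphabet : {set Sigma};
  trans : set (transition loc var Sigma);
  loc0 : loc;
  eval0 : {ffun var -> bool};
  trans_alphabet : forall t, trans t -> tlabel t \in alphabet
}.

Definition local_config (Sigma : finType) (K : component Sigma) : Type :=
  (loc K * {ffun var K -> bool})%type.

(* The finite set of components is a finite family, so that distinct          *)
(* components of a system may be structurally identical.                      *)
(* (s, s') \in prio means that s' has priority over s.                        *)
Record system (Sigma : finType) := System {
  idx : finType;
  comp : idx -> component Sigma;
  prio : {set Sigma * Sigma}
}.

Section Semantics.
Variables (Sigma : finType) (S : system Sigma).

Definition config : Type := forall i : idx S, local_config (comp i).

Definition init_config : config := fun i => (loc0 (comp i), eval0 (comp i)).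

Definition can_fire (K : component Sigma) (q : local_config K) (s : Sigma)
    (t : transition (loc K) (var K) Sigma) : Prop :=
  [/\ trans t, tsrc t = q.1, tlabel t = s & feval q.2 (tguard t)].

Definition fire (K : component Sigma) (q : local_config K)
    (t : transition (loc K) (var K) Sigma) : local_config K :=
  (ttgt t, [ffun v => feval q.2 (tupdate t v)]).

Definition joint_participation (c : config) (s : Sigma) : Prop :=
  forall i : idx S, s \in alphabet (comp i) -> exists t, can_fire (c i) s t.

Definition enabled (c : config) (s : Sigma) : Prop :=
  joint_participation c s /\
  ~ exists s' : Sigma, joint_participation c s' /\ (s, s') \in prio S.

Definition step (c : config) (s : Sigma) (c' : config) : Prop :=
  enabled c s /\
  forall i : idx S,
    if s \in alphabet (comp i)
    then exists t, can_fire (c i) s t /\ c' i = fire (c i) t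
    else c' i = c i.

Fixpoint run_from (c : config) (w : seq Sigma) : Prop :=
  if w is s :: w' then exists c', step c s c' /\ run_from c' w' else True.

Definition lang : set (seq Sigma) := [set w | run_from init_config w].

End Semantics.

Record dfa (Sigma : finType) := DFA {
  dfa_state : finType;
  dfa_init : dfa_state;
  dfa_trans : dfa_state -> Sigma -> dfa_state;
  dfa_final : {set dfa_state}
}.

Definition dfa_lang (Sigma : finType) (A : dfa Sigma) : set (seq Sigma) :=
  [set w | foldl (@dfa_trans _ A) (dfa_init A) w \in dfa_final A].

Definition dfa_compl (Sigma : finType) (A : dfa Sigma) : dfa Sigma :=
  DFA (dfa_init A) (@dfa_trans _ A) (~: dfa_final A).

Lemma dfa_lang_compl (Sigma : finType) (A : dfa Sigma) :
  dfa_lang (dfa_compl A) = ~` dfa_lang A.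
Proof.
by apply/seteqP; split=> w; rewrite /dfa_lang /= finset.in_setC => /negP.
Qed.

Definition B_safe (Sigma : finType) (S : system Sigma) (R : dfa Sigma) : Prop :=
  lang S `&` dfa_lang R = set0.

Definition legal_priority (Sigma : finType) (P : {set Sigma * Sigma}) : Prop :=
  irreflexive (fun a b => (a, b) \in P) /\ transitive (fun a b => (a, b) \in P).

(* Sigma x A *)
Definition prio_to (Sigma : finType) (A : {set Sigma}) : {set Sigma * Sigma} :=
  finset.setX [set: Sigma]%SET A.

Section Stutter.
Variables (Sigma : finType) (A : {set Sigma}).

Definition stutter_trans : set (transition unit void Sigma) :=
  [set t | exists2 s, s \in A
         & t = Transition tt FTrue s (of_void (formula void)) tt].

Lemma stutter_trans_alphabet t : stutter_trans t -> tlabel t \in A.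
Proof. by case=> s sA ->. Qed.

Definition stutter : component Sigma :=
  Component tt [ffun v : void => of_void bool v] stutter_trans_alphabet.

End Stutter.

(* Sets of components are subsets C of a finite ambient family K.             *)
Section Decomposition.
Variables (Sigma I : finType) (K : I -> component Sigma).

Definition labels_of (C : {set I}) : {set Sigma} :=
  (\bigcup_(i in C) alphabet (K i))%SET.

Definition labels_both (C1 C2 : {set I}) : {set Sigma} :=
  labels_of C1 :&: labels_of C2.

Definition labels_only (C1 C2 : {set I}) : {set Sigma} :=
  labels_of C1 :\: labels_of C2.

Definition sys_of (C : {set I}) (P : {set Sigma * Sigma}) : system Sigma :=
  System (fun i : {i : I | i \in C} => K (val i)) P.

(* the system (C ∪ {d}, Sigma, P); index None is the additional component d *)
Definition sys_with (C : {set I}) (d : component Sigma)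
    (P : {set Sigma * Sigma}) : system Sigma :=
  System (fun o : option {i : I | i \in C} =>
            if o is Some i then K (val i) else d) P.

End Decomposition.

(* Main.v *)
Require Import Defs.
From mathcomp Require Import all_boot.
From mathcomp Require Import boolp classical_sets.

Local Open Scope classical_set_scope.

(** Restricting configurations to the components in [D], and keeping the
    stuttering component at its only configuration, turns every run of the full
    system into a run of the subsystem on the same word. Joint participation is
    inherited by the subsystem; it is reflected for labels private to [D], and
    only such labels are preferred by the subsystem's priorities, so no enabled
    label becomes blocked. Hence a word of S+ lies in the languages of both S1+
    and S2+, and either [A] or its complement accepts it. *)

Section Projection.
Set Implicit Arguments.
Unset Strict Implicit.
Variables (Sigma I : finType) (K : I -> component Sigma) (C D : {set I}).
Variables (B : {set Sigma}) (P Q : {set Sigma * Sigma}).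
Hypothesis sDC : D \subset C.

Definition widen_idx (i : {i : I | i \in D}) : {i : I | i \in C} :=
  exist _ (val i) (fintype.subsetP sDC _ (valP i)).

Definition stutter_config : local_config (stutter B) :=
  (tt, [ffun v : void => of_void bool v]).

Definition proj_config (c : config (sys_of K C P)) :
    config (sys_with K D (stutter B) Q) :=
  fun o => if o is Some i then c (widen_idx i) else stutter_config.

Lemma stutter_config_unique (q : local_config (stutter B)) :
  q = stutter_config.
Proof. by case: q => [[] e]; congr (_, _); apply/ffunP; case. Qed.

Lemma proj_init_config :
  proj_config (@init_config _ (sys_of K C P)) = @init_config _ _.
Proof. by apply: functional_extensionality_dep => -[]. Qed.

Lemma stutter_can_fire (q : local_config (stutter B)) s :
  s \in B -> exists t, can_fire q s t.
Proof.
move=> sB; exists (Transition tt FTrue s (of_void (formula void)) tt).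
by case: q => [[] e]; split=> //; exists s.
Qed.

Lemma joint_participation_proj c s :
  joint_participation c s -> joint_participation (proj_config c) s.
Proof.
move=> jp [i|] /=; first exact: (jp (widen_idx i)).
exact: stutter_can_fire.
Qed.

(** A component can veto a label only if its alphabet contains it, so the components of [C] outside
    [D] impose nothing on [s]. *)
Lemma joint_participation_lift c s :
  (forall i, i \in C -> i \notin D -> s \notin alphabet (K i)) ->
  joint_participation (proj_config c) s -> joint_participation c s.
Proof.
move=> private jp [i iC] /= si.
have [iD|/(private _ iC)] := boolP (i \in D); last by rewrite si.
have := jp (Some (exist _ i iD)) si; rewrite /= /widen_idx /=.
(* The two indices carry different proofs of [i \in C], which are equal by irrelevance. *)
by rewrite (bool_irrelevance (fintype.subsetP sDC _ _) iC).
Qed.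

Hypothesis sQP : Q \subset P.
Hypothesis Qprivate : forall s s' i, (s, s') \in Q ->
  i \in C -> i \notin D -> s' \notin alphabet (K i).

Lemma step_proj c s c' :
  step c s c' -> step (proj_config c) s (proj_config c').
Proof.
move=> [[jp top] next]; split; first split.
- exact: joint_participation_proj.
(* A label [s'] blocking [s] in the subsystem would lift to one blocking it in the full system. *)
- move=> [s' [jp' Qs]]; apply: top; exists s'; split; last exact: (fintype.subsetP sQP).
  by apply: joint_participation_lift jp' => i; apply: Qprivate Qs.
- move=> [i|]; first exact: (next (widen_idx i)).
  (* For [s] in [B] the self-loop must be taken, but it returns to the only configuration. *)
  rewrite /=; case: ifPn => // /(stutter_can_fire stutter_config)[t ft].
  by exists t; split=> //; rewrite [RHS]stutter_config_unique.
Qed.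

Lemma lang_proj :
  lang (sys_of K C P) `<=` lang (sys_with K D (stutter B) Q).
Proof.
move=> w; rewrite /lang /= -proj_init_config.
(* The induction needs an arbitrary starting configuration. *)
elim: w (@init_config _ (sys_of K C P)) => //= s w IHw c [c' [cc' run]].
by exists (proj_config c'); split; [exact: step_proj | exact: IHw].
Qed.

End Projection.

(** Such an [i] lies in [C2], whose components share no label with [labels_only K C1 C2]. *)
Lemma labels_only_notin (Sigma I : finType) (K : I -> component Sigma)
    (C1 C2 : {set I}) (i : I) (s : Sigma) :
  s \in labels_only K C1 C2 -> i \in C1 :|: C2 -> i \notin C1 ->
  s \notin alphabet (K i).
Proof.
rewrite inE => /andP[sC2 _] iC iC1.
have {iC iC1} iC2 : i \in C2 by move: iC; rewrite inE (negPf iC1).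
by apply: contra sC2 => si; apply/finset.bigcupP; exists i.
Qed.

Lemma restricted_prio_target {Sigma : finType} {P Q : {set Sigma * Sigma}}
    {A : {set Sigma}} {s s' : Sigma} :
  Q \subset prio_to A -> (s, s') \in P :&: prio_to A :|: Q -> s' \in A.
Proof.
move=> /fintype.subsetP sQ; rewrite !inE => /orP[|/sQ]; last by rewrite !inE.
by case/andP.
Qed.

Theorem theorem3 (Sigma I : finType) (K : I -> component Sigma)
    (C1 C2 : {set I}) (Sigma12 Sigma1 Sigma2 : {set Sigma})
    (hSigma12 : Sigma12 = labels_both K C1 C2)
    (hSigma1 : Sigma1 = labels_only K C1 C2)
    (hSigma2 : Sigma2 = labels_only K C2 C1)
    (hSigma : Sigma12 :|: Sigma1 :|: Sigma2 = [set: Sigma]%SET)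
    (P P1 P2 : {set Sigma * Sigma})
    (hP : P \subset prio_to (Sigma1 :|: Sigma2))
    (R A : dfa Sigma)
    (hP1 : P1 \subset prio_to Sigma1)
    (hP2 : P2 \subset prio_to Sigma2)
    (hlegal : legal_priority (P :|: P1 :|: P2))
    (hS1 : lang (sys_with K C1 (stutter Sigma2) (P :&: prio_to Sigma1 :|: P1))
           `&` dfa_lang R `&` dfa_lang A = set0)
    (hS2 : lang (sys_with K C2 (stutter Sigma1) (P :&: prio_to Sigma2 :|: P2))
           `&` dfa_lang (dfa_compl A) = set0) :
  B_safe (sys_of K (C1 :|: C2) (P :|: P1 :|: P2)) R.
Proof.
subst Sigma12 Sigma1 Sigma2; apply/seteqP; split=> // w [wS wR].
have wS1 : lang (sys_with K C1 (stutter (labels_only K C2 C1))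
    (P :&: prio_to (labels_only K C1 C2) :|: P1)) w.
  apply: lang_proj wS; first exact: finset.subsetUl.
    by rewrite -finset.setUA finset.setUSS ?finset.subsetIl ?finset.subsetUl.
  move=> s s' i /(restricted_prio_target hP1); exact: labels_only_notin.
have wS2 : lang (sys_with K C2 (stutter (labels_only K C1 C2))
    (P :&: prio_to (labels_only K C2 C1) :|: P2)) w.
  apply: lang_proj wS; first exact: finset.subsetUr.
    by rewrite finset.setSU // finset.subIset // finset.subsetUl.
  move=> s s' i /(restricted_prio_target hP2); rewrite finset.setUC.
  exact: labels_only_notin.
have [wA|wA] := pselect (dfa_lang A w).
(* The goal is [set0 w]; reading [set0] as the intersection assumed empty leaves only known
   memberships of [w]. *)
- by rewrite -hS1.
- by rewrite -hS2 dfa_lang_compl.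
Qed.
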